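(* Let $\mu_k>10$. Then $$\|\mathcal{L}_k^{-1}\|_{B(\ell^1)}\le C(\mu_k)$$ and the bound takes the values $$1.612+0.1\ \text{ for }\mu_k>10,\qquad 1.472+0.01\ \text{ for }\mu_k>100,\qquad 1.454+0.001\ \text{ for }\mu_k>1000.$$
   Context: $\mu_k$ is a real number. $C(\mu_k)=1.612+0.1$ for $\mu_k\in(10,100]$, $C(\mu_k)=1.472+0.01$ for $\mu_k\in(100,1000]$, $C(\mu_k)=1.454+0.001$ for $\mu_k>1000$ (so the second displayed list means that each of the three numbers is an upper bound for $\|\mathcal{L}_k^{-1}\|_{B(\ell^1)}$ on the indicated range). $\ell^1$ is the space of real sequences $y=(y_j)_{j\ge0}$ with $\|y\|_{\ell^1}=|y_0|+2\sum_{j\ge1}|y_j|<\infty$, and $\|\cdot\|_{B(\ell^1)}$ is the induced operator norm. $\mathcal{L}_k$ is given by $(\mathcal{L}_ky)_0=y_0+2\sum_{\ell\ge1}(-1)^\ell y_\ell$ and $(\mathcal{L}_ky)_j=\mu_ky_{j-1}+2j\,y_j-\mu_ky_{j+1}$ for $j\ge1$. The statement includes that $\mathcal{L}_k$ is boundedly invertible on $\ell^1$: for every $z\in\ell^1$ there is a unique $y\in\ell^1$ with $\mathcal{L}_ky=z$, and $\mathcal{L}_k^{-1}:z\mapsto y$ is bounded. *)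

(* Defs.v *)
From HB Require Import structures.
From mathcomp Require Import all_boot all_order all_algebra.
From mathcomp Require Import all_classical all_reals all_analysis.

Set Implicit Arguments.
Unset Strict Implicit.
Unset Printing Implicit Defensive.

Import Order.TTheory GRing.Theory Num.Theory.
Import numFieldNormedType.Exports.

Local Open Scope classical_set_scope.
Local Open Scope ring_scope.

Section Defs.
Variable R : realType.
Implicit Types (y z : nat -> R) (mu : R) (T : (nat -> R) -> (nat -> R)).

Definition ell1_norm y : \bar R :=
  (`|y 0%N|%:E + 2%:E * \sum_(1 <= j <oo) `|y j|%:E)%E.

Definition ell1 : set (nat -> R) := [set y | (ell1_norm y < +oo)%E].

(* Total on all sequences; the row of index 0 is the limit of its partial sums,
   which is meaningful on ell1, where the series converges absolutely. *)
Definition calL mu y : nat -> R := fun j =>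
  if j is i.+1 then mu * y i + 2 * j%:R * y j - mu * y j.+1
  else y 0%N + 2 * \big[+%R/0]_(1 <= l <oo) ((-1) ^+ l * y l).

(* calL mu is unbounded on ell1 (because of the factor 2j), so its inverse is a
   pointwise-solution operator. The value outside the range of calL mu on ell1
   is the zero sequence. *)
Definition calLinv mu z : nat -> R :=
  xget (fun=> 0) [set y | ell1 y /\ calL mu y = z].

Definition ell1_bounded T : Prop :=
  exists M : R, forall z, ell1 z -> (ell1_norm (T z) <= M%:E * ell1_norm z)%E.

Definition boundedly_invertible mu : Prop :=
  (forall z, ell1 z -> exists! y, ell1 y /\ calL mu y = z) /\
  ell1_bounded (calLinv mu).

Definition ell1_opnorm T : \bar R :=
  ereal_sup [set ell1_norm (T z) | z in [set z | (ell1_norm z <= 1)%E]].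

(* Only the values for 10 < mu are meaningful. *)
Definition bound_C mu : R :=
  if mu <= 100 then 1612 / 1000 + 1 / 10
  else if mu <= 1000 then 1472 / 1000 + 1 / 100
  else 1454 / 1000 + 1 / 1000.

End Defs.

(* Main.v *)
Require Import Defs.
From HB Require Import structures.
From mathcomp Require Import all_boot all_order all_algebra.
From mathcomp Require Import all_classical all_reals all_analysis.
From mathcomp Require Import ring lra.

Import Order.TTheory GRing.Theory Num.Theory.
Import numFieldNormedType.Exports.

Local Open Scope classical_set_scope.
Local Open Scope ring_scope.

(** The operator is invertible with [ell1_norm (calLinv mu z)] at most 6/5 times
    [ell1_norm z] for every mu > 10, and 6/5 lies below the three constants.

    The rows of index j >= 1 form a three-term recurrence. Its homogeneous version
    has the solutions K_j, positive and nondecreasing ([growing]), and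
    (-1)^j I_j with I_j positive, nonincreasing and summable ([decaying]); up to
    scaling I_j is the modified Bessel function of the first kind I_j(mu), and K_j is
    a positive combination of (-1)^j I_j(mu) and the modified Bessel function of the
    second kind K_j(mu). With the constant W = K_j I_(j+1) + K_(j+1) I_j
    ([wronskianE]), the Green's function of these rows has the absolute values
    I_max(i,j) K_min(i,j) / (mu W) ([green]), so variation of constants gives a
    solution p of the rows j >= 1 ([particular]).

    The norm of p is controlled column by column ([green_column]). Summing the
    recurrence telescopes: the sum of 2 j K_j over j <= n is about
    mu (K_n + K_(n+1)), and likewise for I. Since 3 <= j for all but two indices, this
    bounds the sums of K_j and of I_j themselves by about mu/3 times their value at
    the edge i. On the other side, W is at least 1.7 K_i I_i ([wronskian_lb]). For
    mu >= 10 every column of the Green's function then has norm at most 6/5,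
    while the unit sequence at i >= 1 has norm 2.

    Row 0 is repaired by adding c (-1)^j I_j. As row 0 applied to
    (-1)^j I_j gives precisely the norm of that sequence, the correction costs at most
    |z_0| plus the norm of p, whence the total is at most
    |z_0| + 2 * (3/5) * (norm of the rest of z) ([calL_solvable]).

    For uniqueness, the Casoratian of a summable null vector with (-1)^j I_j
    changes only its sign from one index to the next, and tends to 0; so it vanishes,
    the null vector is a multiple of (-1)^j I_j, and row 0 makes the multiple 0
    ([calL_injective]). *)

(** * The growing solution of the recurrence *)

Fixpoint growing {R : realType} (mu : R) (n : nat) : R :=
  if n is m.+1 then
    if m is k.+1 then growing mu k + 2 * m%:R / mu * growing mu m else 1
  else 1.

Lemma growingSS {R : realType} (mu : R) n :
  growing mu n.+2 = growing mu n + 2 * n.+1%:R / mu * growing mu n.+1.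
Proof. by []. Qed.

Lemma growing0 {R : realType} (mu : R) : growing mu 0 = 1. Proof. by []. Qed.

Lemma growing1 {R : realType} (mu : R) : growing mu 1 = 1. Proof. by []. Qed.

Arguments growing : simpl never.

(** The differences d_n = K_(n+1) - K_n satisfy d_(n+1) + d_n = (2(n+1)/mu) K_(n+1),
    so monotonicity has to be propagated together with an upper bound on d_n. *)
Lemma growing_monotone {R : realType} (mu : R) n : 0 < mu ->
  0 < growing mu n <= growing mu n.+1.
Proof.
move=> mu0.
suff [] : [/\ 0 < growing mu n, growing mu n <= growing mu n.+1
   & growing mu n.+1 - growing mu n <= 2 * n.+1%:R / mu * growing mu n.+1].
  by move=> -> ->.
elim: n => [|n [K0 K01 IH]].
  by rewrite growing0 growing1 subrr ltr01 lexx mulr1 mulr1; split => //; rewrite divr_ge0// ltW.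
have K2 := growingSS mu n.
have a0 : 0 < 2 / mu by rewrite divr_gt0.
have e m : 2 * m%:R / mu = m%:R * (2 / mu) by ring.
have le2 : growing mu n.+1 <= growing mu n.+2 by rewrite K2; lra.
split=> //; first exact: lt_le_trans K01.
have K1 : 0 < growing mu n.+1 by exact: lt_le_trans K01.
rewrite {1}K2.
have -> : growing mu n + 2 * n.+1%:R / mu * growing mu n.+1 - growing mu n.+1
   = 2 * n.+1%:R / mu * growing mu n.+1 - (growing mu n.+1 - growing mu n) by ring.
apply: (@le_trans _ _ (2 * n.+1%:R / mu * growing mu n.+1)); first by lra.
apply: ler_pM => //; first by rewrite !mulr_ge0// invr_ge0 ltW.
  exact: ltW.
by rewrite !e ler_pM2r// ler_nat.
Qed.

(** * The decaying solution of the recurrence *)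

(** The coefficientwise form of the recurrence for [decaying]. *)
Lemma central_bin_step {R : realType} (m i : nat) :
  m.+1%:R * ('C(m.*2, m + i)%:R - 'C(m.*2, m + i.+2)%:R) =
  i.+1%:R * 'C(m.+1.*2, m.+1 + i.+1)%:R :> R.
Proof.
have e : (m.+1 + i.+1 = (m + i).+2)%N by rewrite addSn addnS.
rewrite doubleS e !binS !addnS !natrD.
have shift k : (k <= m)%N ->
    (m + k).+1%:R * 'C(m.*2, (m + k).+1)%:R
    = (m%:R - k%:R) * 'C(m.*2, m + k)%:R :> R.
  move=> km; rewrite -natrM mul_bin_left natrM -natrB//.
  by rewrite -addnn subnDl.
have [im|mi] := ltnP i m.
  have h1 := shift _ (ltnW im); have h2 := shift _ im.
  rewrite addnS -!natr1 !natrD in h1 h2; rewrite -!natr1.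
  set a := 'C(_, m + i)%:R in h1 *; set b := 'C(_, (m + i).+1)%:R in h1 h2 *.
  set c := 'C(_, (m + i).+2)%:R in h2 *.
  by lra.
have small k : (m <= k)%N -> 'C(m.*2, (m + k).+1) = 0%N.
  by move=> mk; rewrite bin_small// -addnn ltnS leq_add2l.
rewrite -(addnS m i) !small ?addnS ?small//; last exact: leqW.
move: mi; rewrite leq_eqVlt => /predU1P[<-|mi]; first by lra.
by rewrite bin_small ?mulr0 -?addnn ?ltn_add2l//; lra.
Qed.

Definition decaying_term {R : realType} (mu : R) (j m : nat) : R :=
  (mu / 2) ^+ m / m`!%:R * 'C(m.*2, m + j)%:R.

(** [decaying mu j] is e^mu I_j(mu), I_j the modified Bessel function of the first kind:
    it is the coefficient of x^j in exp ((mu/2) (x^(1/2) + x^(-1/2))^2). The usual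
    power series of I_j(mu) is not monotone in j term by term; this expansion is,
    because central binomial coefficients are unimodal. *)
Definition decaying {R : realType} (mu : R) (j : nat) : R :=
  limn (series (decaying_term mu j)).

Lemma decaying_term_ge0 {R : realType} (mu : R) j m : 0 < mu ->
  0 <= decaying_term mu j m.
Proof. by move=> m0; rewrite !mulr_ge0// ?invr_ge0// exprn_ge0// ltW// divr_gt0. Qed.

Lemma bin_le_exp2 n k : ('C(n, k) <= 2 ^ n)%N.
Proof.
elim: n k => [|n IH] [|k] //; first by rewrite bin0 expn_gt0.
by rewrite binS expnS mul2n -addnn leq_add.
Qed.

Lemma decaying_cvg {R : realType} (mu : R) j : 0 < mu ->
  series (decaying_term mu j) @ \oo --> decaying mu j.
Proof.
move=> mu0; apply: (@series_le_cvg _ _ (exp_coeff (2 * mu))).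
- by move=> m; exact: decaying_term_ge0.
- by move=> m; rewrite exp_coeff_ge0// mulr_ge0// ltW.
- move=> m; rewrite /exp_coeff /= (_ : 2 * mu = (mu / 2) * 4); last by field.
  rewrite exprMn mulrAC /decaying_term ler_wpM2l//.
    by rewrite divr_ge0// exprn_ge0// divr_ge0// ltW.
  rewrite (_ : 4 = 2 ^+ 2); last by ring.
  by rewrite -exprM mul2n -natrX ler_nat bin_le_exp2.
- exact: is_cvg_series_exp_coeff.
Qed.

Lemma decaying_ge_term {R : realType} (mu : R) j m : 0 < mu ->
  decaying_term mu j m <= decaying mu j.
Proof.
move=> mu0; have nd : nondecreasing_seq (series (decaying_term mu j)).
  by apply/nondecreasing_seqP => n; rewrite seriesSr lerDl decaying_term_ge0.
apply: le_trans (nondecreasing_cvgn_le nd _ m.+1); last first.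
  exact/cvgP/decaying_cvg.
rewrite seriesSr lerDr /series /=.
by apply: sumr_ge0 => k _; exact: decaying_term_ge0.
Qed.

Lemma decaying_gt0 {R : realType} (mu : R) j : 0 < mu -> 0 < decaying mu j.
Proof.
move=> mu0; apply: lt_le_trans (decaying_ge_term _ j j mu0).
by rewrite /decaying_term addnn binn mulr1 divr_gt0 ?exprn_gt0 ?divr_gt0 ?ltr0n ?fact_gt0.
Qed.

Lemma bin_central_noninc m j : ('C(m.*2, m + j.+1) <= 'C(m.*2, m + j))%N.
Proof.
rewrite addnS -(@leq_pmul2l (m + j).+1)// mul_bin_left leq_mul2r.
by apply/orP; right; rewrite -addnn subnDl (leq_trans (leq_subr _ _))// leqW// leq_addr.
Qed.

Lemma decaying_noninc {R : realType} (mu : R) j : 0 < mu ->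
  decaying mu j.+1 <= decaying mu j.
Proof.
move=> mu0; have h i := cvgP _ (decaying_cvg mu i mu0).
apply: ler_lim; [exact: h|exact: h|].
apply: nearW => n; rewrite /series /=; apply: ler_sum => m _.
rewrite /decaying_term ler_wpM2l ?ler_nat ?bin_central_noninc//.
by rewrite mulr_ge0 ?invr_ge0// exprn_ge0// ltW// divr_gt0.
Qed.

(** The term of index 0 in [decaying mu j.+1] vanishes, which allows comparing the other
    terms after a shift of the summation index. *)
Lemma decayingSS {R : realType} (mu : R) j : 0 < mu ->
  decaying mu j = decaying mu j.+2 + 2 * j.+1%:R / mu * decaying mu j.+1.
Proof.
move=> mu0; have h i := decaying_cvg mu i mu0.
suff e n : series (decaying_term mu j) n = series (decaying_term mu j.+2) n
    + 2 * j.+1%:R / mu * series (decaying_term mu j.+1) n.+1.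
  rewrite {1}/decaying (funext e); apply/cvg_lim => //.
  by apply: cvgD => //; apply: cvgMr; rewrite cvg_shiftS.
rewrite /series /= big_nat_recl//.
rewrite [decaying_term mu j.+1 0](_ : _ = 0) ?add0r; last first.
  by rewrite /decaying_term bin0n mulr0.
rewrite mulr_sumr -big_split /=; apply: eq_bigr => m _.
apply/eqP; rewrite -subr_eq0; apply/eqP.
have st := @central_bin_step R m j; rewrite /decaying_term exprS factS natrM.
have f0 : m`!%:R != 0 :> R by rewrite pnatr_eq0 -lt0n fact_gt0.
have m0 : m.+1%:R != 0 :> R by rewrite pnatr_eq0.
have muN0 : mu != 0 by rewrite gt_eqF.
transitivity ((mu / 2) ^+ m / m`!%:R / m.+1%:R *
  (m.+1%:R * ('C(m.*2, m + j)%:R - 'C(m.*2, m + j.+2)%:R)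
   - j.+1%:R * 'C(m.+1.*2, m.+1 + j.+1)%:R)); last first.
  by rewrite st subrr mulr0.
by field; rewrite nat1r f0 m0 muN0.
Qed.

(** * Sums of the two solutions *)

Lemma sum_growing {R : realType} (mu : R) n : 0 < mu ->
  2 / mu * \sum_(1 <= j < n.+1) j%:R * growing mu j
  = growing mu n + growing mu n.+1 - 2.
Proof.
move=> mu0; elim: n => [|n IH]; first by rewrite big_geq// growing0 growing1 mulr0; ring.
by rewrite big_nat_recr// mulrDr IH growingSS; ring.
Qed.

Lemma sum_decaying {R : realType} (mu : R) i n : 0 < mu -> (i <= n)%N ->
  2 / mu * \sum_(i.+1 <= j < n.+1) j%:R * decaying mu j
  = decaying mu i + decaying mu i.+1 - (decaying mu n + decaying mu n.+1).
Proof.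
move=> mu0; elim: n => [|n IH].
  by rewrite leqn0 => /eqP ->; rewrite big_geq//= mulr0 subrr.
rewrite leq_eqVlt => /predU1P[->|]; first by rewrite big_geq//= mulr0 subrr.
rewrite ltnS => le_in; rewrite big_nat_recr//= mulrDr IH// (decayingSS mu n)//.
by ring.
Qed.

(** From 3 <= j for j >= 3, the sum of 3 K_j is at most that of j K_j, which
    telescopes; the deficit 2 K_1 + K_2 of the first two indices is at most 3 K_n. *)
Lemma growing_partial_sum {R : realType} (mu : R) n : 0 < mu ->
  3 * \sum_(1 <= j < n.+1) growing mu j
  <= mu / 2 * (growing mu n + growing mu n.+1) + 3 * growing mu n.
Proof.
move=> mu0; have K_ m := growing_monotone mu m mu0.
suff : 3 * \sum_(1 <= j < n.+1) growing mu j
    <= \sum_(1 <= j < n.+1) j%:R * growing mu j + 3 * growing mu n.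
  move=> /le_trans; apply; rewrite lerD2r.
  set S := \sum_(_ <= _ < _) _.
  have -> : S = mu / 2 * (2 / mu * S) by field; rewrite gt_eqF.
  by rewrite sum_growing// ler_wpM2l//; [rewrite divr_ge0// ltW|lra].
elim: n => [|[|[|n]] IH].
- by rewrite !big_geq// growing0; lra.
- by rewrite !big_nat1 growing1; lra.
- have /andP[_ K12] := K_ 1%N.
  by do 2!rewrite (@big_nat_recr _ _ _ 2)//=; rewrite !big_nat1; lra.
- do 2!rewrite (@big_nat_recr _ _ _ n.+3)//=.
  have /andP[K0 KS] := K_ n.+2.
  have : 3 * growing mu n.+3 <= n.+3%:R * growing mu n.+3.
    by rewrite ler_pM2r ?ler_nat// (lt_le_trans K0).
  by move: KS IH; move: (growing mu n.+3) (growing mu n.+2) => x y; lra.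
Qed.

(** As for [growing_partial_sum]; since i >= 1, the only index with j < 3 is j = 2, which
    occurs when i = 1 and costs I_2 <= I_i. *)
Lemma decaying_partial_sum {R : realType} (mu : R) i n : 0 < mu -> (0 < i <= n)%N ->
  3 * \sum_(i.+1 <= j < n.+1) decaying mu j
  <= mu / 2 * (decaying mu i + decaying mu i.+1) + decaying mu i.
Proof.
move=> mu0 /andP[i0 le_in]; have I0 m := decaying_gt0 mu m mu0.
have Id m := decaying_noninc mu m mu0.
suff : 3 * \sum_(i.+1 <= j < n.+1) decaying mu j
    <= \sum_(i.+1 <= j < n.+1) j%:R * decaying mu j + (i < n)%:R * decaying mu i.
  move=> /le_trans; apply; apply: lerD; last first.
    by rewrite ler_piMl ?lern1 ?leq_b1// ltW.
  set S := \sum_(_ <= _ < _) _.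
  have -> : S = mu / 2 * (2 / mu * S) by field; rewrite gt_eqF.
  rewrite sum_decaying// ler_wpM2l//; first by rewrite divr_ge0// ltW.
  by rewrite lerBlDr lerDl addr_ge0// ltW.
elim: n le_in => [|n IH].
  by rewrite leqNgt i0.
rewrite leq_eqVlt => /predU1P[->|].
  by rewrite !big_geq// ltnn mul0r mulr0 addr0.
rewrite ltnS => le_in; rewrite le_in mul1r.
do 2!rewrite (@big_nat_recr _ _ _ n.+1)//=.
move: (IH le_in); have := Id n; move: le_in; rewrite leq_eqVlt => /predU1P[ein|lt_in].
  rewrite ein ltnn mul0r => Idn.
  have : 2 * decaying mu n.+1 <= n.+1%:R * decaying mu n.+1.
    by rewrite ler_pM2r// ler_nat ltnS -ein.
  by lra.
rewrite lt_in mul1r => _.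
have : 3 * decaying mu n.+1 <= n.+1%:R * decaying mu n.+1.
  by rewrite ler_pM2r// ler_nat ltnS (leq_ltn_trans i0).
by lra.
Qed.

(** * The Green's function *)

Definition wronskian {R : realType} (mu : R) : R :=
  growing mu 0 * decaying mu 1 + growing mu 1 * decaying mu 0.

Lemma wronskianE {R : realType} (mu : R) i : 0 < mu ->
  growing mu i * decaying mu i.+1 + growing mu i.+1 * decaying mu i = wronskian mu.
Proof.
move=> mu0; elim: i => // i <-; rewrite (decayingSS mu i)// growingSS; ring.
Qed.

Lemma wronskian_gt0 {R : realType} (mu : R) : 0 < mu -> 0 < wronskian mu.
Proof. by move=> mu0; rewrite addr_gt0 ?mulr_gt0 ?decaying_gt0. Qed.

(** The absolute values of the entries of the Green's function, without the signs, which
    are those of (-1)^(i+j) for i <= j and + for i > j. *)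
Definition green {R : realType} (mu : R) (i j : nat) : R :=
  growing mu (minn i j) * decaying mu (maxn i j) / (mu * wronskian mu).

(** The convex function 1/x lies above its tangent at x = 10/7; that point, near sqrt 2, is
    where the sum of the two bounds in [wronskian_lb] is nearly smallest. *)
Lemma tangent_lb {R : realType} (x a b : R) : 0 < x -> 0 <= b -> b <= x * a ->
  (7 / 5 - 49 / 100 * x) * b <= a.
Proof.
move=> x0 b0 bxa; rewrite -(ler_pM2l x0); apply: le_trans bxa.
rewrite mulrA ler_piMl//.
have : 0 <= (1 - 7 / 10 * x) ^+ 2 by exact: sqr_ge0.
lra.
Qed.

(** Let i stand for the index i.+1 of the statement and u = 2i/mu. Then
    W / (K_i I_i) = K_(i-1)/K_i + I_(i+1)/I_i + u, and the recurrences bound the two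
    ratios below by 1/(1+u) and 1/(1+u+2/mu). The decrease in u of the tangents to
    these (slope -0.49 each) is compensated by the term u. *)
Lemma wronskian_lb {R : realType} (mu : R) i : 10 <= mu ->
  17 / 10 * (growing mu i.+1 * decaying mu i.+1) <= wronskian mu.
Proof.
move=> mu10; have mu0 : 0 < mu by lra.
have /andP[K0 K01] := growing_monotone mu i mu0.
have I2 := decaying_gt0 mu i.+2 mu0.
have I1 := decaying_gt0 mu i.+1 mu0.
have Id3 := decaying_noninc mu i.+2 mu0.
have I3 := decayingSS mu i.+1 mu0.
rewrite -(wronskianE mu i)// (decayingSS mu i)//.
set u := 2 * i.+1%:R / mu.
have u0 : 0 <= u by rewrite divr_ge0// ltW.
(* 2/mu <= 1/5, as mu >= 10 *)
have uE : 2 * i.+2%:R / mu <= u + 1/5.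
  rewrite -[i.+2%:R]natr1 mulrDr mulrDl lerD2l mulr1 ler_pdivrMr//; lra.
have Kle : growing mu i.+1 <= (1 + u) * growing mu i.
  case: (i) @u u0 uE K0 K01 => [|m] u u0 uE K0 K01; first by rewrite growing0 growing1 mulr1; lra.
  have /andP[Km Km1] := growing_monotone mu m mu0.
  rewrite growingSS [leRHS]mulrDl mul1r lerD// ler_wpM2r//; first by rewrite ltW// (lt_le_trans Km).
  by rewrite /u ler_wpM2r ?invr_ge0 ?(ltW mu0)// ler_wpM2l// ler_nat.
have Ile : decaying mu i.+1 <= (6/5 + u) * decaying mu i.+2.
  by rewrite I3; nra.
have K1 : 0 < growing mu i.+1 by exact: lt_le_trans K01.
have x0 : 0 < 1 + u by lra.
have y0 : 0 < 6 / 5 + u by lra.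
have := ler_wpM2r (ltW I1) (tangent_lb _ _ _ x0 (ltW K1) Kle).
have := ler_wpM2l (ltW K1) (tangent_lb _ _ _ y0 (ltW I1) Ile).
have := mulr_gt0 K1 I1; have := mulr_ge0 u0 (ltW (mulr_gt0 K1 I1)).
lra.
Qed.

(** In units of K_i I_i, the doubled sums over j < i and over j > i are each at most
    about (2/3) mu by the partial sum bounds, so the column is at most
    (4/3) mu + 17/3 against mu W >= 1.7 mu. *)
Lemma green_column {R : realType} (mu : R) i n : 10 < mu -> (0 < i <= n)%N ->
  green mu i 0 + 2 * \sum_(1 <= j < n.+1) green mu i j <= 6 / 5.
Proof.
move=> mu10 /andP[i0 le_in]; have mu0 : 0 < mu by lra.
have W0 := wronskian_gt0 mu mu0.
case: i i0 le_in => // i _ le_in.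
have /andP[K0 K01] := growing_monotone mu i mu0.
have I1 := decaying_gt0 mu i.+1 mu0.
have Id2 := decaying_noninc mu i.+1 mu0.
have Wlb := wronskian_lb mu i (ltW mu10).
have Ks := growing_partial_sum mu i mu0.
have Is := decaying_partial_sum mu i.+1 n mu0 le_in.
set S := \sum_(_ <= _ < _) growing _ _ in Ks *.
set T := \sum_(_ <= _ < _) decaying _ _ in Is *.
have -> : green mu i.+1 0 + 2 * \sum_(1 <= j < n.+1) green mu i.+1 j
  = (growing mu 0 * decaying mu i.+1
     + 2 * (S * decaying mu i.+1 + growing mu i.+1 * decaying mu i.+1
            + growing mu i.+1 * T)) / (mu * wronskian mu).
  rewrite (@big_cat_nat _ _ _ i.+1)//=; last exact: leqW.
  rewrite (@big_ltn _ _ _ i.+1)// /green minn0 maxn0 minnn maxnn.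
  set D := (mu * wronskian mu)^-1.
  have -> : \sum_(1 <= j < i.+1) growing mu (minn i.+1 j)
      * decaying mu (maxn i.+1 j) * D = S * decaying mu i.+1 * D.
    rewrite !mulr_suml !big_nat; apply: eq_bigr => j /andP[_ ji].
    by rewrite (minn_idPr _) ?(maxn_idPl _)// ltnW.
  have -> : \sum_(i.+2 <= j < n.+1) growing mu (minn i.+1 j)
      * decaying mu (maxn i.+1 j) * D = growing mu i.+1 * T * D.
    rewrite mulr_sumr mulr_suml !big_nat; apply: eq_bigr => j /andP[ij _].
    by rewrite (minn_idPl _) ?(maxn_idPr _)// ltnW.
  ring.
rewrite ler_pdivrMr ?mulr_gt0//.
have K1 : 0 < growing mu i.+1 by exact: lt_le_trans K01.
have {}Ks : 3 * S * decaying mu i.+1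
    <= (mu + 3) * (growing mu i.+1 * decaying mu i.+1).
  rewrite [leRHS]mulrA ler_wpM2r ?(ltW I1)//; apply: le_trans Ks _.
  have := ler_wpM2l (ltW mu0) K01; lra.
have {}Is : growing mu i.+1 * (3 * T)
    <= (mu + 1) * (growing mu i.+1 * decaying mu i.+1).
  rewrite [leRHS]mulrCA ler_wpM2l ?(ltW K1)//; apply: le_trans Is _.
  have := ler_wpM2l (ltW mu0) Id2; lra.
have {}Wlb := ler_wpM2l (ltW mu0) Wlb.
have K1I : growing mu 0 * decaying mu i.+1 <= growing mu i.+1 * decaying mu i.+1.
  rewrite ler_wpM2r ?(ltW I1)// growing0 -(growing0 mu).
  elim: (i.+1) => // m /le_trans; apply.
  by have /andP[] := growing_monotone mu m mu0.
have KI0 := mulr_gt0 K1 I1.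
have := ler_wpM2r (ltW KI0) (ltW mu10).
move: K1I Ks Is Wlb KI0; set P := growing mu i.+1 * decaying mu i.+1.
lra.
Qed.

(** * Sequences of finite norm *)

Definition partial_norm {R : realType} (y : nat -> R) (n : nat) : R :=
  `|y 0%N| + 2 * \sum_(1 <= j < n.+1) `|y j|.

(** Bounding the truncated norms keeps all later estimates among real numbers and finite
    sums. *)
Lemma ell1_norm_leP {R : realType} (y : nat -> R) (M : R) :
  (ell1_norm y <= M%:E)%E <-> forall n, partial_norm y n <= M.
Proof.
have nneg j : (1 <= j)%N -> true -> (0 <= `|y j|%:E)%E by rewrite lee_fin.
have pE n : (partial_norm y n)%:E
    = (`|y 0%N|%:E + 2%:E * \sum_(1 <= j < n.+1) `|y j|%:E)%E.
  by rewrite /partial_norm EFinD EFinM sumEFin.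
split=> [h n|h].
  rewrite -lee_fin pE; apply: le_trans h; rewrite /ell1_norm leeD2l//.
  rewrite lee_pmul2l//.
  exact: nneseries_lim_ge.
rewrite /ell1_norm -leeBrDl// -lee_pdivlMl//.
apply: lime_le; first exact: is_cvg_nneseries.
apply: nearW => -[|n]; rewrite lee_pdivlMl// leeBrDl//.
  rewrite big_geq// mule0 adde0 lee_fin; apply: le_trans (h 0%N).
  by rewrite /partial_norm big_geq// mulr0 addr0.
by rewrite -pE lee_fin.
Qed.

Lemma ell1_norm_ge0 {R : realType} (y : nat -> R) : (0 <= ell1_norm y)%E.
Proof. by rewrite adde_ge0// mule_ge0// nneseries_ge0. Qed.

Lemma ell1P {R : realType} (y : nat -> R) :
  ell1 y <-> exists M, forall n, partial_norm y n <= M.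
Proof.
split=> [|[M /ell1_norm_leP h]]; last by rewrite /ell1 /=; exact: le_lt_trans (ltry M).
rewrite /ell1 /= => h; exists (fine (ell1_norm y)); apply/ell1_norm_leP.
by rewrite fineK// ge0_fin_numE// ell1_norm_ge0.
Qed.

Lemma abs_bounded_cvg {R : realType} (a : nat -> R) (M : R) :
  (forall n, \sum_(1 <= l < n.+1) `|a l| <= M) ->
  cvgn (fun n => \sum_(1 <= l < n.+1) a l).
Proof.
move=> h; have shift (b : nat -> R) : (fun n => \sum_(1 <= l < n.+1) b l)
    = series (fun l => b l.+1).
  by apply/funext => n; rewrite big_add1.
rewrite shift; apply: normed_cvg; rewrite -[X in cvgn X](shift (fun l => `|a l|)).
apply: nondecreasing_is_cvgn.
  by apply/nondecreasing_seqP => n; rewrite [leRHS]big_nat_recr// lerDl.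
by exists M => _ [n _ <-]; exact: h.
Qed.

(** The partial sums include the index n, as in [partial_norm], so that the two can be
    compared term by term. *)
Lemma row0_cvg {R : realType} (mu : R) (y : nat -> R) : ell1 y ->
  (fun n => y 0%N + 2 * \sum_(1 <= l < n.+1) ((-1) ^+ l * y l)) @ \oo
     --> calL mu y 0.
Proof.
move=> /ell1P[M hM]; rewrite /calL; apply: cvgD; first exact: cvg_cst.
apply: cvgMr; rewrite (cvg_shiftS (fun n => \sum_(1 <= l < n) ((-1) ^+ l * y l))).
suff : cvgn (fun n => \sum_(1 <= l < n.+1) ((-1) ^+ l * y l)).
  by move=> /cvg_ex[l];
    rewrite (cvg_shiftS (fun n => \sum_(1 <= l < n) ((-1) ^+ l * y l))) => /cvgP.
apply: (@abs_bounded_cvg _ _ (M / 2)) => n.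
rewrite ler_pdivlMr// mulrC; apply: le_trans (hM n).
rewrite /partial_norm; under eq_bigr do rewrite normrM normrX normrN1 expr1n mul1r.
by rewrite lerDr.
Qed.

Lemma row0_le {R : realType} (mu : R) (y : nat -> R) (M : R) :
  (forall n, partial_norm y n <= M) -> `|calL mu y 0| <= M.
Proof.
move=> hM; have c : ell1 y by apply/ell1P; exists M.
have cv : `|y 0%N + 2 * \sum_(1 <= l < n.+1) ((-1) ^+ l * y l)| @[n --> \oo]
    --> `|calL mu y 0|.
  by apply: cvg_norm; exact: row0_cvg.
rewrite -(cvg_lim _ cv)//; apply: limr_le; first exact: cvgP cv.
apply: nearW => n.
apply: le_trans (hM n); apply: le_trans (ler_normD _ _) _.
rewrite lerD2l normrM ger0_norm// ler_wpM2l//.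
apply: le_trans (ler_norm_sum _ _ _) _; apply: ler_sum => l _.
by rewrite normrM normrX normrN1 expr1n mul1r.
Qed.

Lemma partial_norm_comb {R : realType} (x y : nat -> R) (c : R) n :
  partial_norm (fun j => x j + c * y j) n
  <= partial_norm x n + `|c| * partial_norm y n.
Proof.
have le j : `|x j + c * y j| <= `|x j| + `|c| * `|y j| by rewrite -normrM ler_normD.
rewrite /partial_norm.
have : \sum_(1 <= j < n.+1) `|x j + c * y j|
    <= \sum_(1 <= j < n.+1) `|x j| + `|c| * \sum_(1 <= j < n.+1) `|y j|.
  by rewrite mulr_sumr -big_split /=; apply: ler_sum.
by have := le 0%N; lra.
Qed.

Lemma ell1_comb {R : realType} (x y : nat -> R) (c : R) :
  ell1 x -> ell1 y -> ell1 (fun j => x j + c * y j).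
Proof.
move=> /ell1P[M hM] /ell1P[N hN]; apply/ell1P; exists (M + `|c| * N) => n.
apply: le_trans (partial_norm_comb _ _ _ _) _.
by rewrite lerD// ler_wpM2l.
Qed.

Lemma calL_comb {R : realType} (mu : R) (x y : nat -> R) (c : R) j :
  ell1 x -> ell1 y ->
  calL mu (fun j => x j + c * y j) j = calL mu x j + c * calL mu y j.
Proof.
move=> hx hy; case: j => [|j]; last by rewrite /=; ring.
apply: (cvg_unique (@norm_hausdorff _ R^o) (row0_cvg mu _ (ell1_comb _ _ c hx hy))).
rewrite (_ : (fun n => _) = (fun n => x 0%N + 2 * \sum_(1 <= l < n.+1) ((-1) ^+ l * x l)
    + c * (y 0%N + 2 * \sum_(1 <= l < n.+1) ((-1) ^+ l * y l)))).
  by apply: cvgD; [|apply: cvgMr]; exact: row0_cvg.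
apply/funext => n.
set S := \sum_(_ <= _ < _) (_ * x _); set T := \sum_(_ <= _ < _) (_ * y _).
have -> : \sum_(1 <= l < n.+1) ((-1) ^+ l * (x l + c * y l)) = S + c * T.
  by rewrite mulr_sumr -big_split; apply: eq_bigr => l _ /=; ring.
ring.
Qed.

(** * Null vectors of the rows of positive index *)

Definition altdecay {R : realType} (mu : R) (j : nat) : R := (-1) ^+ j * decaying mu j.

Lemma altdecay_row {R : realType} (mu : R) j : 0 < mu ->
  calL mu (altdecay mu) j.+1 = 0.
Proof.
move=> mu0; rewrite /calL /altdecay (decayingSS mu j)// !exprS; field.
by rewrite gt_eqF.
Qed.

Lemma norm_altdecay {R : realType} (mu : R) j : 0 < mu ->
  `|altdecay mu j| = decaying mu j.
Proof.
move=> mu0; rewrite normrM normrX normrN1 expr1n mul1r ger0_norm// ltW//.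
exact: decaying_gt0.
Qed.

Lemma partial_norm_mono {R : realType} (y : nat -> R) m n : (m <= n)%N ->
  partial_norm y m <= partial_norm y n.
Proof.
move=> mn; rewrite lerD2l ler_wpM2l// [leRHS](@big_cat_nat _ _ _ m.+1)//=.
by rewrite lerDl sumr_ge0.
Qed.

Lemma altdecay_ell1 {R : realType} (mu : R) : 0 < mu -> ell1 (altdecay mu).
Proof.
move=> mu0; apply/ell1P.
exists (decaying mu 0 + 2 * (decaying mu 1
  + (mu / 2 * (decaying mu 1 + decaying mu 2) + decaying mu 1) / 3)) => n.
apply: (le_trans (partial_norm_mono _ _ _ (leqnSn n))).
rewrite /partial_norm norm_altdecay// lerD2l ler_wpM2l//.
rewrite (eq_bigr _ (fun j _ => norm_altdecay mu j mu0)) (@big_ltn _ _ _ 1)//.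
by rewrite lerD2l ler_pdivlMr// mulrC decaying_partial_sum.
Qed.

(** The signs of row 0 cancel those of [altdecay], so row 0 of [altdecay mu] is the limit of
    these partial norms. This makes the correction of row 0 cheap. *)
Lemma altdecay_norm_le {R : realType} (mu : R) n : 0 < mu ->
  partial_norm (altdecay mu) n <= calL mu (altdecay mu) 0.
Proof.
move=> mu0; have := row0_cvg mu _ (altdecay_ell1 mu mu0).
rewrite (_ : (fun n => _) = partial_norm (altdecay mu)) => [cv|]; last first.
  apply/funext => m; rewrite /partial_norm norm_altdecay// /altdecay.
  rewrite expr0 mul1r; congr (_ + 2 * _); apply: eq_bigr => j _.
  by rewrite norm_altdecay// mulrA -exprMn mulrNN mulr1 expr1n mul1r.
rewrite -(cvg_lim (@norm_hausdorff _ R^o) cv); apply: nondecreasing_cvgn_le.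
  by move=> *; exact: partial_norm_mono.
exact: cvgP cv.
Qed.

Lemma altdecay_row0_gt0 {R : realType} (mu : R) : 0 < mu ->
  0 < calL mu (altdecay mu) 0.
Proof.
move=> mu0; apply: lt_le_trans (altdecay_norm_le mu 0 mu0).
rewrite /partial_norm big_geq// mulr0 addr0 norm_altdecay//.
exact: decaying_gt0.
Qed.

Lemma ell1_cvg0 {R : realType} (y : nat -> R) : ell1 y -> y @ \oo --> 0.
Proof.
move=> /ell1P[M hM]; have : cvgn (fun n => \sum_(1 <= l < n.+1) y l).
  apply: (@abs_bounded_cvg _ _ (M / 2)) => n.
  rewrite ler_pdivlMr// mulrC; apply: le_trans (hM n).
  by rewrite /partial_norm lerDr.
rewrite (_ : (fun n => _) = series (fun l => y l.+1)); last first.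
  by apply/funext => n; rewrite big_add1.
by move=> /cvg_series_cvg_0; rewrite cvg_shiftS.
Qed.

Definition casoratian {R : realType} (x y : nat -> R) j : R :=
  x j * y j.+1 - x j.+1 * y j.

Lemma casoratian_step {R : realType} (mu : R) (x y : nat -> R) j : 0 < mu ->
  calL mu x j.+1 = 0 -> calL mu y j.+1 = 0 ->
  casoratian x y j.+1 = - casoratian x y j.
Proof.
move=> mu0 hx hy; have rec z : calL mu z j.+1 = 0 ->
    z j.+2 = z j + 2 * j.+1%:R / mu * z j.+1.
  move=> /= /eqP; rewrite subr_eq0 => /eqP hz.
  have muN0 : mu != 0 by rewrite gt_eqF.
  by apply: (mulfI muN0); rewrite -hz; field.
by rewrite /casoratian (rec _ hx) (rec _ hy); ring.
Qed.

(** A null vector y and (-1)^j I_j have a Casoratian of constant absolute value; both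
    sequences tend to 0, so it is 0 and y is a multiple of (-1)^j I_j. *)
Lemma calL_injective {R : realType} (mu : R) (y : nat -> R) : 0 < mu -> ell1 y ->
  (forall j, calL mu y j = 0) -> y = fun=> 0.
Proof.
move=> mu0 ely hy; pose h := altdecay mu.
have elh : ell1 h := altdecay_ell1 mu mu0.
have h0 j : h j != 0.
  by rewrite -normr_gt0 norm_altdecay// decaying_gt0.
have Cabs j : `|casoratian y h j| = `|casoratian y h 0|.
  elim: j => // j <-; rewrite (casoratian_step mu)// ?normrN//.
  exact: altdecay_row.
have C0 : casoratian y h 0 = 0.
  have Sy : y n.+1 @[n --> \oo] --> 0 by rewrite (cvg_shiftS y); exact: ell1_cvg0.
  have Sh : h n.+1 @[n --> \oo] --> 0 by rewrite (cvg_shiftS h); exact: ell1_cvg0.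
  have : casoratian y h n @[n --> \oo] --> (0 * 0 - 0 * 0 : R).
    by apply: cvgB; apply: cvgM => //; exact: ell1_cvg0.
  rewrite mul0r subrr => /cvgr0_norm_lt lim0.
  apply/eqP/negPn/negP => C0; rewrite -normr_gt0 in C0.
  have [n _ /(_ n (leqnn n))] := lim0 _ C0.
  by rewrite /= Cabs ltxx.
have step j : y j * h j.+1 = y j.+1 * h j.
  by apply/eqP; rewrite -subr_eq0 -normr_eq0 -/(casoratian y h j) Cabs C0 normr0.
have yE j : y j = h j + (y 0%N / h 0%N - 1) * h j.
  suff : y j = y 0%N / h 0%N * h j by move=> ->; ring.
  elim: j => [|j IH]; first by rewrite divfK.
  by apply: (mulIf (h0 j)); rewrite -step {1}IH; ring.
have := hy 0%N; rewrite {1}(funext yE) calL_comb// => /eqP.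
rewrite mulrBl mul1r addrC subrK mulf_eq0 [X in _ || X]gt_eqF; last first.
  exact: altdecay_row0_gt0.
by rewrite orbF => /eqP c0; apply/funext => j; rewrite yE c0; ring.
Qed.

(** * Solving the equation *)

Definition pairing {R : realType} (mu : R) (z : nat -> R) n : R :=
  \sum_(1 <= i < n.+1) decaying mu i * z i.

(** Variation of constants. The coefficient of the growing solution has to be the tail
    sum of I_i z_i over i > j, that is [t - pairing mu z j] with t the full sum. Keeping t
    free makes the rows a finite computation, and lets truncations of z share
    the formula. *)
Definition particular {R : realType} (mu : R) (z : nat -> R) (t : R) (j : nat) : R :=
  (altdecay mu j * (\sum_(1 <= i < j.+1) (-1) ^+ i * growing mu i * z i)
   + growing mu j * (t - pairing mu z j)) / (mu * wronskian mu).

(** Any t works here, since changing t adds a multiple of the growing null vector. *)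
Lemma particular_row {R : realType} (mu : R) (z : nat -> R) (t : R) j : 0 < mu ->
  calL mu (particular mu z t) j.+1 = z j.+1.
Proof.
move=> mu0; have W0 := wronskian_gt0 mu mu0.
pose A n := \sum_(1 <= i < n.+1) (-1) ^+ i * growing mu i * z i.
have AS n : A n.+1 = A n + (-1) ^+ n.+1 * growing mu n.+1 * z n.+1.
  by rewrite /A big_nat_recr.
have PS n : pairing mu z n.+1 = pairing mu z n + decaying mu n.+1 * z n.+1.
  by rewrite /pairing big_nat_recr.
rewrite /calL /particular -/(A j) -/(A j.+1) -/(A j.+2) !AS !PS /altdecay.
rewrite -(wronskianE mu j)// in W0 *.
move: W0; rewrite (decayingSS mu j)// growingSS !exprS -signr_odd.
move: (A j) (pairing mu z j) (growing mu j) (growing mu j.+1) (decaying mu j.+1) (decaying mu j.+2).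
move=> a p k K I J W0.
have muN0 : mu != 0 by rewrite gt_eqF.
have D0 : k * I * mu + K * (J * mu + 2 * (1 + j%:R) * I) != 0.
  rewrite nat1r; set D := (X in X != 0).
  rewrite (_ : D = mu * (k * I + K * (J + 2 * j.+1%:R / mu * I))).
    by rewrite mulf_neq0// gt_eqF.
  by rewrite /D; field.
by case: (odd j); rewrite ?expr0 ?expr1; field; rewrite muN0 D0.
Qed.

(** With t = [pairing mu z m], the formula is, for indices j <= m, the solution for z
    truncated after m, a finite combination of columns of the Green's function. *)
Lemma particular_approx {R : realType} (mu : R) (z : nat -> R) m j : 0 < mu ->
  (j <= m)%N ->
  `|particular mu z (pairing mu z m) j|
  <= \sum_(1 <= i < m.+1) green mu i j * `|z i|.
Proof.
move=> mu0 jm; have W0 := wronskian_gt0 mu mu0.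
have I0 i := ltW (decaying_gt0 mu i mu0).
have K0 i : 0 <= growing mu i by have /andP[/ltW] := growing_monotone mu i mu0.
rewrite /particular.
have -> : pairing mu z m - pairing mu z j
    = \sum_(j.+1 <= i < m.+1) decaying mu i * z i.
  by rewrite /pairing (@big_cat_nat _ _ _ j.+1 1 m.+1)//=; ring.
rewrite normrM (gtr0_norm (_ : 0 < _^-1)) ?invr_gt0 ?mulr_gt0//.
rewrite ler_pdivrMr ?mulr_gt0// mulr_suml (@big_cat_nat _ _ _ j.+1 1 m.+1)//=.
have greenK i : green mu i j * `|z i| * (mu * wronskian mu)
    = growing mu (minn i j) * decaying mu (maxn i j) * `|z i|.
  by rewrite /green mulrAC divfK// mulf_neq0// gt_eqF.
apply: le_trans (ler_normD _ _) _; apply: lerD; rewrite normrM.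
  rewrite norm_altdecay// (le_trans (ler_wpM2l (I0 j) (ler_norm_sum _ _ _)))//.
  rewrite mulr_sumr !big_nat; apply: ler_sum => i /andP[_]; rewrite ltnS => ij.
  rewrite greenK (minn_idPl _)// (maxn_idPr _)//.
  rewrite !normrM normrX normrN1 expr1n mul1r (ger0_norm (K0 i)).
  by rewrite mulrA [in leLHS](mulrC (decaying _ _)).
rewrite (ger0_norm (K0 j)) (le_trans (ler_wpM2l (K0 j) (ler_norm_sum _ _ _)))//.
rewrite mulr_sumr !big_nat; apply: ler_sum => i /andP[ji _].
rewrite greenK (minn_idPr _) ?(maxn_idPl _) ?(ltnW ji)//.
by rewrite normrM (ger0_norm (I0 i)) mulrA.
Qed.

(** Exchanging the two finite sums reduces the bound to [green_column]. *)
Lemma particular_norm_approx {R : realType} (mu : R) (z : nat -> R) (M : R) m : 10 < mu ->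
  (forall n, \sum_(1 <= i < n.+1) `|z i| <= M) ->
  partial_norm (particular mu z (pairing mu z m)) m <= 6 / 5 * M.
Proof.
move=> mu10 hM; have mu0 : 0 < mu by lra.
have := fun j => particular_approx mu z m j mu0.
set p := particular _ _ _ => hp.
apply: (@le_trans _ _ (\sum_(1 <= i < m.+1)
  (green mu i 0 + 2 * \sum_(1 <= j < m.+1) green mu i j) * `|z i|)); last first.
  apply: (@le_trans _ _ (6 / 5 * \sum_(1 <= i < m.+1) `|z i|)).
    rewrite mulr_sumr !big_nat; apply: ler_sum => i /andP[i1 im].
    by rewrite ler_wpM2r// green_column// i1 -ltnS.
  by rewrite ler_wpM2l.
apply: (@le_trans _ _ (\sum_(1 <= i < m.+1) green mu i 0 * `|z i|
  + 2 * \sum_(1 <= j < m.+1) \sum_(1 <= i < m.+1) green mu i j * `|z i|)).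
  rewrite lerD ?hp// ler_wpM2l// !big_nat; apply: ler_sum => j /andP[_ jm].
  exact: hp.
rewrite exchange_big_nat//= mulr_sumr -big_split /= le_eqVlt; apply/orP; left.
by apply/eqP; apply: eq_bigr => i _; rewrite -mulr_suml; ring.
Qed.

Lemma pairing_cvg {R : realType} (mu : R) (z : nat -> R) : 0 < mu -> ell1 z ->
  cvgn (pairing mu z).
Proof.
move=> mu0 /ell1P[M hM]; apply: (@abs_bounded_cvg _ _ (decaying mu 0 * M)) => n.
apply: (@le_trans _ _ (decaying mu 0 * \sum_(1 <= i < n.+1) `|z i|)).
  rewrite mulr_sumr; apply: ler_sum => i _.
  rewrite normrM ler_wpM2r// gtr0_norm ?decaying_gt0//.
  by elim: i => // i IH; exact: le_trans (decaying_noninc mu i mu0) IH.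
rewrite ler_wpM2l ?(ltW (decaying_gt0 mu 0 mu0))//; apply: le_trans (hM n).
rewrite /partial_norm.
have : 0 <= `|z 0%N| by [].
have : 0 <= \sum_(1 <= j < n.+1) `|z j| by exact: sumr_ge0.
lra.
Qed.

(** For m >= n, the solution differs from its truncation at m by
    (t - pairing mu z m) K_j / (mu W); on the indices up to n this tends to 0 with m. *)
Lemma particular_norm {R : realType} (mu : R) (z : nat -> R) (M : R) n : 10 < mu ->
  ell1 z -> (forall n, \sum_(1 <= i < n.+1) `|z i| <= M) ->
  partial_norm (particular mu z (limn (pairing mu z))) n <= 6 / 5 * M.
Proof.
move=> mu10 elz hM; have mu0 : 0 < mu by lra.
set t := limn _; have ct : pairing mu z @ \oo --> t by exact: pairing_cvg.
have W0 := wronskian_gt0 mu mu0.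
pose c := partial_norm (growing mu) n / (mu * wronskian mu).
have le m : (n <= m)%N ->
  partial_norm (particular mu z t) n <= 6 / 5 * M + `|t - pairing mu z m| * c.
  move=> nm; pose q := particular mu z (pairing mu z m).
  have -> : particular mu z t
      = fun j => q j + (t - pairing mu z m) / (mu * wronskian mu) * growing mu j.
    by apply/funext => j; rewrite /q /particular; ring.
  apply: le_trans (partial_norm_comb _ _ _ _) _; apply: lerD.
    exact: le_trans (partial_norm_mono _ _ _ nm) (particular_norm_approx mu z M m mu10 hM).
  by rewrite normrM (gtr0_norm (_ : 0 < _^-1)) ?invr_gt0 ?mulr_gt0// /c mulrAC mulrA.
have lim0 : 6 / 5 * M + `|t - pairing mu z m| * c @[m --> \oo] --> 6 / 5 * M + `|t - t| * c.
  apply: cvgD; first exact: cvg_cst.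
  by apply: cvgMl; apply: cvg_norm; apply: cvgB => //; exact: cvg_cst.
rewrite subrr normr0 mul0r addr0 in lim0.
rewrite -(cvg_lim (@norm_hausdorff _ R^o) lim0); apply: limr_ge; first exact: cvgP lim0.
by exists n => // m /= nm; exact: le.
Qed.

Lemma calL_solvable {R : realType} (mu : R) (z : nat -> R) (N : R) : 10 < mu ->
  (forall n, partial_norm z n <= N) ->
  exists y, [/\ calL mu y = z & forall n, partial_norm y n <= 6 / 5 * N].
Proof.
move=> mu10 hN; have mu0 : 0 < mu by lra.
have elz : ell1 z by apply/ell1P; exists N.
pose M := (N - `|z 0%N|) / 2.
have hM n : \sum_(1 <= i < n.+1) `|z i| <= M.
  by have := hN n; rewrite /partial_norm /M; lra.
pose p := particular mu z (limn (pairing mu z)).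
have hp n : partial_norm p n <= 6 / 5 * M by exact: particular_norm.
have elp : ell1 p by apply/ell1P; exists (6 / 5 * M).
pose h := altdecay mu; pose r := calL mu h 0.
have elh : ell1 h := altdecay_ell1 mu mu0.
have r0 : 0 < r := altdecay_row0_gt0 mu mu0.
pose c := (z 0%N - calL mu p 0) / r.
exists (fun j => p j + c * h j); split.
  apply/funext => j; rewrite calL_comb//; case: j => [|j].
    by rewrite -/r /c divfK ?gt_eqF// addrC subrK.
  by rewrite altdecay_row// particular_row// mulr0 addr0.
move=> n; apply: le_trans (partial_norm_comb _ _ _ _) _.
have cr : `|c| * partial_norm h n <= `|z 0%N| + 6 / 5 * M.
  apply: (@le_trans _ _ (`|c| * r)).
    by rewrite ler_wpM2l// altdecay_norm_le.
  rewrite -[X in _ * X <= _](gtr0_norm r0) -normrM divfK ?gt_eqF//.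
  by rewrite (le_trans (ler_normB _ _))// lerD2l row0_le.
have := hp n; have : 0 <= `|z 0%N| by []. 
rewrite /M in cr *; lra.
Qed.

Lemma calL_unique {R : realType} (mu : R) (x y : nat -> R) : 0 < mu ->
  ell1 x -> ell1 y -> calL mu x = calL mu y -> x = y.
Proof.
move=> mu0 elx ely xy.
have := calL_injective mu (fun j => x j + -1 * y j) mu0 (ell1_comb _ _ _ elx ely).
move=> H; apply/funext => j; apply/eqP; rewrite -subr_eq0 -mulN1r; apply/eqP.
apply: (congr1 (fun f => f j) (H _)) => i.
by rewrite calL_comb// xy; ring.
Qed.

Lemma calLinvP {R : realType} (mu : R) (z : nat -> R) : 10 < mu -> ell1 z ->
  (ell1 (calLinv mu z) /\ calL mu (calLinv mu z) = z) /\
  (ell1_norm (calLinv mu z) <= (6 / 5)%:E * ell1_norm z)%E.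
Proof.
move=> mu10 elz; have mu0 : 0 < mu by lra.
have nz : (fine (ell1_norm z))%:E = ell1_norm z.
  by rewrite fineK// ge0_fin_numE// ell1_norm_ge0.
have hN : forall n, partial_norm z n <= fine (ell1_norm z).
  by apply/ell1_norm_leP; rewrite nz.
have [y [yz hy]] := calL_solvable mu z _ mu10 hN.
have ely : ell1 y by apply/ell1P; eexists; exact: hy.
have -> : calLinv mu z = y.
  apply: xget_unique => // x [elx xz].
  by apply: (calL_unique mu) => //; rewrite xz.
by split => //; rewrite -nz -EFinM; apply/ell1_norm_leP.
Qed.

Theorem corollary3p29 (R : realType) (mu : R) (hmu : 10 < mu) :
  [/\ boundedly_invertible mu,
      (ell1_opnorm (calLinv mu) <= (bound_C mu)%:E)%E,
      (ell1_opnorm (calLinv mu) <= (1612 / 1000 + 1 / 10 : R)%:E)%E,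
      100 < mu ->
        (ell1_opnorm (calLinv mu) <= (1472 / 1000 + 1 / 100 : R)%:E)%E
    & 1000 < mu ->
        (ell1_opnorm (calLinv mu) <= (1454 / 1000 + 1 / 1000 : R)%:E)%E].
Proof.
have opnorm : (ell1_opnorm (calLinv mu) <= (6 / 5)%:E)%E.
  apply: ge_ereal_sup => _ [z /= z1 <-].
  have elz : ell1 z by exact: le_lt_trans z1 (ltry 1).
  have [_ /le_trans] := calLinvP mu z hmu elz; apply.
  by rewrite -[leRHS]mule1 lee_pmul2l// lte_fin.
have weaken (c : R) : 6 / 5 <= c -> (ell1_opnorm (calLinv mu) <= c%:E)%E.
  by move=> hc; apply: le_trans opnorm _; rewrite lee_fin.
split; [split|..].
- move=> z elz; have [[ely yz] _] := calLinvP mu z hmu elz.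
  exists (calLinv mu z); split => // x [elx xz].
  by apply: (calL_unique mu) => //; [lra|rewrite yz xz].
- by exists (6 / 5) => z elz; have [] := calLinvP mu z hmu elz.
- by apply: weaken; rewrite /bound_C; case: ifP => _; [|case: ifP => _]; lra.
- by apply: weaken; lra.
- by move=> _; apply: weaken; lra.
- by move=> _; apply: weaken; lra.
Qed.
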